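(* Let $N\ge 1$ be an integer, let $1\le p<\infty$ and $1\le q<\infty$, and let $u:\mathbb{R}^N\to\mathbb{R}$ be a measurable function. If $$\left[\frac{u(x)-u(y)}{|x-y|^{\frac{N}{p}+1}}\right]_{L^{p,q}(\mathbb{R}^N\times\mathbb{R}^N)}<\infty,$$ then $u$ is constant.
   Context: $\mathcal{L}^{2N}$ is Lebesgue measure on $\mathbb{R}^N\times\mathbb{R}^N$. For a measurable function $f$ on $\mathbb{R}^N\times\mathbb{R}^N$ and $1\le p<\infty$, $1\le q<\infty$, the Lorentz quasi-norm $[f]_{L^{p,q}(\mathbb{R}^N\times\mathbb{R}^N)}\in[0,\infty]$ is defined by $$[f]_{L^{p,q}(\mathbb{R}^N\times\mathbb{R}^N)}^q=p\int_0^\infty\lambda^q\,\mathcal{L}^{2N}\bigl(\{(x,y)\in\mathbb{R}^N\times\mathbb{R}^N:\ |f(x,y)|\ge\lambda\}\bigr)^{\frac{q}{p}}\frac{d\lambda}{\lambda}.$$ The difference quotient is regarded as a function of $(x,y)$, defined for $x\neq y$ (i.e. almost everywhere). As usual for measurable functions, ''$u$ is constant'' means that $u$ coincides almost everywhere with a constant. *)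

(* Defs.v *)
From HB Require Import structures.
From mathcomp Require Import all_boot all_order all_algebra.
From mathcomp Require Import all_classical all_reals all_analysis.

Set Implicit Arguments.
Unset Strict Implicit.
Unset Printing Implicit Defensive.
Import Order.TTheory GRing.Theory Num.Theory.
Import numFieldNormedType.Exports.

Local Open Scope classical_set_scope.
Local Open Scope ring_scope.
Local Open Scope ereal_scope.

Lemma product_measure_sigma_finite {R : realType} {d1 d2 : measure_display}
    {T1 : measurableType d1} {T2 : measurableType d2}
    (m1 : {sigma_finite_measure set T1 -> \bar R})
    (m2 : {sigma_finite_measure set T2 -> \bar R}) :
  sigma_finite setT (m1 \x m2).
Proof.
have /sigma_finiteP[F [TF ndF Foo]] := sigma_finiteT m1.
have /sigma_finiteP[G [TG ndG Goo]] := sigma_finiteT m2.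
exists (fun n => F n `*` G n).
  rewrite -setXTT TF TG predeqE => -[x y]; split.
    move=> [/= [n _ Fnx] [k _ Gky]]; exists (maxn n k) => //; split.
    - by move: x Fnx; exact/subsetPset/ndF/leq_maxl.
    - by move: y Gky; exact/subsetPset/ndG/leq_maxr.
  by move=> [n _ []/= ? ?]; split; exists n.
move=> k; have [? ?] := Foo k; have [? ?] := Goo k.
split; first exact: measurableX.
by rewrite product_measure1E// lte_mul_pinfty// ge0_fin_numE.
Qed.

Section tuple_measure.
Context {R : realType} {d : measure_display} {T : measurableType d}.
Variable m : {sigma_finite_measure set T -> \bar R}.

Definition tuple_cons n (z : T * n.-tuple T) : n.+1.-tuple T :=
  [tuple of z.1 :: z.2].

Lemma measurable_tuple_cons n : measurable_fun setT (@tuple_cons n).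
Proof.
by apply: measurable_cons; [exact: measurable_fst|exact: measurable_snd].
Qed.

Section tuple_measure_succ.
Variables (n : nat) (mu : {sigma_finite_measure set (n.-tuple T) -> \bar R}).

Definition tuple_measure_succ : set (n.+1.-tuple T) -> \bar R :=
  pushforward (m \x mu) (@tuple_cons n).

Let tuple_measure_succ0 : tuple_measure_succ set0 = 0.
Proof. by rewrite /tuple_measure_succ /pushforward preimage_set0 measure0. Qed.

Let tuple_measure_succ_ge0 A : 0 <= tuple_measure_succ A.
Proof. exact: (measure_ge0 (m \x mu)). Qed.

Let tuple_measure_succ_sigma_additive : semi_sigma_additive tuple_measure_succ.
Proof.
move=> F mF tF mUF; rewrite /tuple_measure_succ /pushforward preimage_bigcup.
have mpre A : measurable A -> measurable (@tuple_cons n @^-1` A).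
  by move=> mA; rewrite -[X in measurable X]setTI; exact: measurable_tuple_cons.
apply: measure_semi_sigma_additive.
- by move=> k; exact: mpre.
- apply/trivIsetP => /= i j _ _ ij; rewrite -preimage_setI.
  by move/trivIsetP : tF => /(_ _ _ _ _ ij) ->//; rewrite preimage_set0.
- by rewrite -preimage_bigcup; exact: mpre.
Qed.

HB.instance Definition _ := isMeasure.Build _ _ _ tuple_measure_succ
  tuple_measure_succ0 tuple_measure_succ_ge0 tuple_measure_succ_sigma_additive.

Let tuple_measure_succ_sigma_finite : sigma_finite setT tuple_measure_succ.
Proof.
have [F FT Ffin] := product_measure_sigma_finite m mu.
pose h (x : n.+1.-tuple T) : T * n.-tuple T :=
  (tnth x ord0, [tuple of behead x]).
have mh : measurable_fun setT h.
  by apply: measurable_fun_pair; [exact: measurable_tnth|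
                                  exact: measurable_behead].
have hK : cancel (@tuple_cons n) h.
  by move=> [a t]; rewrite /h /tuple_cons /=; congr pair; apply: val_inj.
exists (fun k => h @^-1` F k).
  by rewrite -preimage_bigcup -FT preimage_setT.
move=> k; have [mF Foo] := Ffin k; split.
  by rewrite -[X in measurable X]setTI; exact: mh.
rewrite /tuple_measure_succ /pushforward -comp_preimage.
by rewrite (_ : h \o _ = id) //; apply/funext => z; exact: hK.
Qed.

HB.instance Definition _ := Measure_isSigmaFinite.Build _ _ _ tuple_measure_succ
  tuple_measure_succ_sigma_finite.

End tuple_measure_succ.

(* The n-fold product measure m \x ... \x m (the unit mass when n = 0). *)
Fixpoint tuple_measure n : {sigma_finite_measure set (n.-tuple T) -> \bar R} :=
  match n with
  | 0 => \d_([tuple] : 0.-tuple T)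
  | n'.+1 => tuple_measure_succ (tuple_measure n')
  end.

End tuple_measure.

Section euclidean_space.
Variables (R : realType) (n : nat).

(* R^n with the n-fold product of the Borel sigma-algebra of R. *)
Definition Rn : measurableType _ := (n.-tuple (measurableTypeR R))%type.

Definition borel_lebesgue : {sigma_finite_measure set Rn -> \bar R} :=
  tuple_measure (@lebesgue_measure R) n.

(* The type Rn equipped with the sigma-algebra of Lebesgue measurable sets. *)
Definition lebesgue_type := caratheodory_type (borel_lebesgue^*)%mu.

(* The Lebesgue measures on R^n and on R^n * R^n (the latter is the
   2n-dimensional one), complete thanks to the Caratheodory extension. *)
Definition lebesgue := @completed_measure_extension _ _ _ borel_lebesgue.

Definition lebesgue2 :=
  @completed_measure_extension _ _ _ (borel_lebesgue \x borel_lebesgue).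

Definition euclidean_dist (x y : Rn) : R :=
  Num.sqrt (\sum_(i < n) ((tnth x i : R) - (tnth y i : R)) ^+ 2).

(* At x = y, where the quotient is undefined, this is 0 (the numerator is). *)
Definition diff_quotient (p : R) (u : Rn -> R) (z : Rn * Rn) : R :=
  (u z.1 - u z.2) / euclidean_dist z.1 z.2 `^ (n%:R / p + 1).

End euclidean_space.

Arguments lebesgue : clear implicits.
Arguments lebesgue2 : clear implicits.

Definition lorentz_norm {R : realType} {T : Type} (mu : set T -> \bar R)
    (p q : R) (f : T -> R) : \bar R :=
  (p%:E * \int[lebesgue_measure]_(l in `]0%R, +oo[)
     ((l `^ q)%:E * mu [set z | (l <= `|f z|)%R] `^ (q / p) * (l^-1)%:E))
  `^ q^-1.

(* Main.v *)
(* Put m(l) for the measure of {|f| >= l}, f the difference quotient.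
   Finiteness of the Lorentz norm with q < oo forces l^p m(l) -> 0 along
   l = L 2^j. Replacing u by a Borel version composed with t / (1 + |t|), we may
   assume that u is Borel with |u(x) - u(y)| <= 2.
   Let I_k be the integral of (|u(x) - u(y)| - s|x - y|)_+^p over the shell
   r 2^(-k-1) < |x - y| <= r 2^(-k). Passing through the midpoint z of x and y,
   convexity of t^p and the substitution y |-> z give I_k <= 2^(N+p) I_(k+1).
   Hence K I_0 <= sum_(k < K) 2^(k(N+p)) I_k, and since |x - y| is comparable to
   r 2^(-k) on the k-th shell this sum is at most a constant times the integral
   of |f|^p over {L <= |f| < L 2^J} with L = s r^(-N/p) and J = O(K), i.e. at
   most a constant times sum_(j < J) (L 2^j)^p m(L 2^j) = o(K). So I_0 = 0 for
   all s and r, that is u(x) = u(y) for almost every (x, y). *)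
Require Import Defs.
From HB Require Import structures.
From mathcomp Require Import all_boot all_order all_algebra.
From mathcomp Require Import all_classical all_reals all_analysis.
From mathcomp Require Import measurable_realfun ring lra.

Set Implicit Arguments.
Unset Strict Implicit.
Unset Printing Implicit Defensive.
Import Order.TTheory GRing.Theory Num.Theory.
Import numFieldNormedType.Exports.

Local Open Scope classical_set_scope.
Local Open Scope ring_scope.

(** * Borel approximation of Caratheodory measurable sets and functions *)

Section completion.
Local Open Scope ereal_scope.
Context {d : measure_display} {T : measurableType d} {R : realType}.

(** Intersect measurable covers of [X] whose measures exceed its outer measure by at most [1/(n+1)];
    when the outer measure is infinite, the whole space serves. *)
Lemma measurable_hull (mu : {measure set T -> \bar R}) (X : set T) :
  exists C, [/\ measurable C, X `<=` C & mu C = (mu^*)%mu X].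
Proof.
have le_hull C : measurable C -> X `<=` C -> (mu^*)%mu X <= mu C.
  by move=> mC XC; rewrite -(measurable_mu_extE mu mC) le_outer_measure.
have [Xoo|Xfin] := eqVneq ((mu^*)%mu X) +oo.
  exists setT; split => //; apply/eqP; rewrite eq_le {1}Xoo leey/=.
  exact: le_hull.
have {}Xfin : (mu^*)%mu X \is a fin_num.
  by rewrite ge0_fin_numE ?outer_measure_ge0// ltey.
have /choice[C CP] (n : nat) : exists C, [/\ measurable C, X `<=` C &
    mu C <= (mu^*)%mu X + n.+1%:R^-1%:E].
  have n0 : (0 < n.+1%:R^-1 :> R)%R by rewrite invr_gt0.
  have [_ [F [mF XF] <-] Flt] := lb_ereal_inf_adherent n0 Xfin.
  exists (\bigcup_k F k); split => //; first exact: bigcupT_measurable.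
  apply: le_trans (ltW Flt); apply: measure_sigma_subadditive => //.
  exact: bigcupT_measurable.
have mC : measurable (\bigcap_n C n).
  by apply: bigcapT_measurable => n; have [] := CP n.
have XC : X `<=` \bigcap_n C n.
  by apply: sub_bigcap => n _; have [] := CP n.
exists (\bigcap_n C n); split => //.
apply/eqP; rewrite eq_le le_hull// andbT.
apply/lee_addgt0Pr => _/posnumP[e]; near \oo => n.
have [mCn _ Cn] := CP n.
apply: (@le_trans _ _ (mu (C n))).
  by apply: le_measure; rewrite ?inE//; exact: bigcap_inf.
rewrite (le_trans Cn)// leeD2l// lee_fin ltW//.
by near: n; exact: near_infty_natSinv_lt.
Unshelve. all: by end_near. Qed.

(** On a piece of finite measure, testing the Caratheodory condition on the hull [C n] and
    cancelling the finite mass shows that [C n] minus the piece of [A] has outer measure 0. A hull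
    of this difference is then a measurable null set, and countably many pieces suffice. *)
Lemma caratheodory_measurable_hull (mu : {sigma_finite_measure set T -> \bar R})
    (A : set T) : (mu^*)%mu.-cara.-measurable A ->
  exists B Z, [/\ measurable B, measurable Z, mu Z = 0, A `<=` B &
    B `\` A `<=` Z].
Proof.
move=> mA; have [F TF Ffin] := sigma_finiteT mu.
have /choice[C CP] n := measurable_hull mu (A `&` F n).
have /choice[Z ZP] n := measurable_hull mu (C n `\` (A `&` F n)).
exists (\bigcup_n C n), (\bigcup_n Z n); split.
- by apply: bigcupT_measurable => n; have [] := CP n.
- by apply: bigcupT_measurable => n; have [] := ZP n.
- have mZ n : measurable (Z n) by have [] := ZP n.
  apply/negligibleP; first exact: bigcupT_measurable.
  apply: negligible_bigcup => n; apply/negligibleP => //.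
  have [mC subC muC] := CP n; have [_ _ muZ] := ZP n; apply: etrans muZ _.
  have [mF Foo] := Ffin n.
  have mAF : (mu^*)%mu.-cara.-measurable (A `&` F n).
    by apply: measurableI => //; exact: caratheodory_measurable_mu_ext.
  have finAF : (mu^*)%mu (A `&` F n) \is a fin_num.
    rewrite ge0_fin_numE ?outer_measure_ge0//.
    apply: (@le_lt_trans _ _ ((mu^*)%mu (F n))).
      by apply: le_mu_ext; exact: subIsetr.
    by rewrite (measurable_mu_extE mu mF); exact: Foo.
  have split0 : (mu^*)%mu (A `&` F n) + 0 = (mu^*)%mu (C n).
    by rewrite adde0 -muC; exact/esym/measurable_mu_extE.
  have := mAF (C n); rewrite [C n `&` (A `&` F n)]setIidr// => /(etrans split0).
  rewrite setDE => splitC; apply/eqP; rewrite eq_le outer_measure_ge0 andbT.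
  by rewrite -(leeD2lE _ _ finAF) -splitC.
- move=> x Ax; have [n _ Fnx] : (\bigcup_n F n) x by rewrite -TF.
  by exists n => //; have [_ subC _] := CP n; apply: subC.
- move=> x [[n _ Cnx] nAx]; exists n => //.
  by have [_ CZ _] := ZP n; apply: CZ; split => // -[].
Qed.

(** Setting [u] to 0 on the union of the null sets attached to the preimages of rational half-lines
    makes these preimages measurable, and they determine all the others. *)
Lemma measurable_fun_caratheodory_ae (mu : {sigma_finite_measure set T -> \bar R})
    (u : T -> R) :
  measurable_fun [set: caratheodory_type (mu^*)%mu] u ->
  exists v Z, [/\ measurable_fun [set: T] v, measurable Z, mu Z = 0 &
    forall x, ~ Z x -> v x = u x].
Proof.
move=> mu_u.
(* An enumeration of the rationals, with 0 at the integers that encode none. *)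
pose q (n : nat) : R := ratr (odflt 0%R (unpickle n)).
have /choice[B /choice[Z BZ]] n :=
  caratheodory_measurable_hull (mu_u measurableT _ (measurable_itv `]q n, +oo[)).
have mB n : measurable (B n) by have [] := BZ n.
have mZ n : measurable (Z n) by have [] := BZ n.
have mUZ : measurable (\bigcup_n Z n) by exact: bigcupT_measurable.
pose v x : R := if x \in \bigcup_n Z n then 0%R else u x.
exists v, (\bigcup_n Z n); split => //; last 2 first.
- apply/negligibleP => //; apply: negligible_bigcup => n.
  by apply/negligibleP => //; have [] := BZ n.
- by move=> x Zx; rewrite /v memNset.
have mvq n : measurable (v @^-1` `]q n, +oo[).
  (* Since [v] is 0 on the exceptional set, that set lies in the preimage exactly when [q n] is
     negative. *)
  have -> : v @^-1` `]q n, +oo[ =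
     (B n `\` \bigcup_n Z n) `|` (if (q n < 0)%R then \bigcup_n Z n else set0).
    apply/seteqP; split => x /=; rewrite in_itv/= andbT /v.
    - case: ifPn => [/set_mem xZ q0|/negP xZ qx].
        by right; rewrite q0.
      left; split => [|/mem_set//]; have [_ _ _ uB _] := BZ n; apply: uB.
      by split => //=; rewrite in_itv/= qx.
    - case=> [[Bx nZx]|]; last by case: ifPn => // q0 /mem_set ->.
      rewrite memNset//; apply: contrapT => nqx; apply: nZx; exists n => //.
      have [_ _ _ _ BuZ] := BZ n; apply: BuZ; split => // -[_] /=.
      by rewrite in_itv/= andbT.
  by apply: measurableU; [exact: measurableD|case: ifP].
apply: (measurability _ (measurable_realfun.RGenOInfty.measurableE R)).
move=> _ [_ [r ->] <-]; rewrite setTI.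
have -> : v @^-1` `]r, +oo[ =
    \bigcup_n (if (r < q n)%R then v @^-1` `]q n, +oo[ else set0).
  apply/seteqP; split => x /=; rewrite in_itv/= andbT.
    move=> rv; have [s] := rat_in_itvoo rv.
    rewrite in_itv/= => /andP[rs sv].
    exists (pickle s) => //; rewrite /q pickleK/= rs /=.
    by rewrite in_itv/= sv.
  move=> [n _]; case: ifPn => // rq /=; rewrite in_itv/= andbT.
  exact: lt_trans.
by apply: bigcupT_measurable => n; case: ifP.
Qed.

End completion.

(** * The substitution that sends a point to its midpoint with a fixed point *)

Section midpoint.
Context {R : realType}.

Definition midpoint n (x y : Rn R n) : Rn R n :=
  [tuple ((tnth x i : R) + (tnth y i : R)) / 2 | i < n].

Lemma measurable_midpoint n (x : Rn R n) : measurable_fun setT (midpoint x).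
Proof.
apply/measurable_fun_tnthP => i.
rewrite (_ : _ \o _ = fun y : Rn R n => ((tnth x i : R) + (tnth y i : R)) / 2).
  apply: measurable_funM => //; apply: measurable_funD => //.
  exact: (@measurable_tnth _ (measurableTypeR R)).
by apply/funext => y /=; rewrite tnth_mktuple.
Qed.

Lemma measurable_midpoint2 n :
  measurable_fun setT (fun z : Rn R n * Rn R n => midpoint z.1 z.2).
Proof.
have mc i : measurable_fun setT (fun x : Rn R n => (tnth x i : R)).
  exact: (@measurable_tnth _ (measurableTypeR R)).
apply/measurable_fun_tnthP => i.
rewrite (_ : _ \o _ = fun z : Rn R n * Rn R n =>
    ((tnth z.1 i : R) + (tnth z.2 i : R)) / 2).
  by apply: measurable_funM => //; apply: measurable_funD => //;
    exact: (measurableT_comp (mc i)).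
by apply/funext => y /=; rewrite tnth_mktuple.
Qed.

Lemma midpointC n (x y : Rn R n) : midpoint x y = midpoint y x.
Proof. by apply: eq_from_tnth => i; rewrite !tnth_mktuple addrC. Qed.

Lemma midpoint_cons n (x : Rn R n.+1) (a : R) (t : Rn R n) :
  midpoint x (tuple_cons ((a : measurableTypeR R), t)) =
  tuple_cons ((((tnth x ord0 : R) + a) / 2 : measurableTypeR R),
              midpoint [tuple of behead x] t).
Proof.
apply: eq_from_tnth => i; rewrite tnth_mktuple.
case: (unliftP ord0 i) => [j|] ->.
  rewrite [RHS](tnth_nth 0) /= -[in RHS](tnth_nth _ (midpoint _ _)).
  by rewrite tnth_mktuple !(tnth_nth 0) /= nth_behead.
by rewrite !(tnth_nth 0).
Qed.

Local Open Scope ereal_scope.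

(** Lebesgue measure is half of its image under [a |-> (c + a) / 2]: by uniqueness it is enough to
    compare the two on half-open intervals. *)
Lemma integral_midpoint1 (c : R) (F : measurableTypeR R -> \bar R) :
  measurable_fun setT F -> (forall a, 0 <= F a) ->
  \int[lebesgue_measure]_a F ((c + a) / 2)%R =
  2%:E * \int[lebesgue_measure]_a F a.
Proof.
move=> mF F0.
pose h (a : measurableTypeR R) : measurableTypeR R := ((c + a) / 2)%R.
have mh : measurable_fun setT h.
  by apply: measurable_funM => //; exact: measurable_funD.
pose nu : {measure set _ -> \bar R} :=
  measure_function_pushforward__canonical__measure_function_Measure
    lebesgue_measure mh.
have half_ge0 : (0 <= 2^-1 :> R)%R by [].
pose half : {nonneg R} := NngNum half_ge0.
have E : forall A, measurable A -> lebesgue_measure A =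
    mscale half nu A.
  apply: lebesgue_measure_unique => _ [[a b] _ <-] /=.
  rewrite /mscale/= /pushforward.
  have -> : h @^-1` `]a, b]%classic = `](2 * a - c)%R, (2 * b - c)%R]%classic.
    by apply/seteqP; split => x; rewrite /= /h !in_itv/=; lra.
  rewrite !lebesgue_measure_itv/= !lte_fin.
  have -> : (2 * a - c < 2 * b - c)%R = (a < b)%R.
    by apply/idP/idP; lra.
  case: ifPn => _; last by rewrite mule0.
  by rewrite -!EFinB -EFinM; congr EFin; field.
rewrite [in RHS](eq_measure_integral
  (mscale half nu)); last first.
  by move=> A mA _; exact: E.
rewrite ge0_integral_mscale// muleA -EFinM divff// mul1e.
by apply/esym; rewrite ge0_integral_pushforward.
Qed.

(** Induction on the dimension: Tonelli splits off the first coordinate, and each coordinate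
    contributes a factor 2. *)
Lemma integral_midpoint n (x : Rn R n) (F : Rn R n -> \bar R) :
  measurable_fun setT F -> (forall y, 0 <= F y) ->
  \int[borel_lebesgue R n]_y F (midpoint x y) =
  (2 ^+ n)%:E * \int[borel_lebesgue R n]_y F y.
Proof.
elim: n => [|n IH] in x F *.
  move=> _ _; rewrite expr0 mul1e; apply: eq_integral => y _; congr F.
  by rewrite tuple0 [RHS]tuple0.
move=> mF F0; rewrite /borel_lebesgue /=.
have mc := @measurable_tuple_cons _ (measurableTypeR R) n.
have mFc : measurable_fun setT (F \o @tuple_cons _ (measurableTypeR R) n).
  exact: measurableT_comp.
have mFm : measurable_fun setT
    (fun z : measurableTypeR R * Rn R n => F (midpoint x (tuple_cons z))).
  apply: (measurableT_comp (f := fun y => F (midpoint x y))) mc.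
  by apply: measurableT_comp => //; exact: measurable_midpoint.
rewrite /tuple_measure_succ.
rewrite ge0_integral_pushforward//; last first.
  by apply: measurableT_comp => //; exact: measurable_midpoint.
rewrite ge0_integral_pushforward//.
rewrite !preimage_setT [RHS](_ : _ = (2 ^+ n.+1)%:E *
    \int[lebesgue_measure \x borel_lebesgue R n]_z F (tuple_cons z))//.
rewrite !fubini_tonelli1//=.
pose G (a : measurableTypeR R) := \int[borel_lebesgue R n]_t F (tuple_cons (a, t)).
have mG : measurable_fun setT G.
  by apply: (measurable_fun_fubini_tonelli_F (m2 := borel_lebesgue R n)
    (fun z => F (tuple_cons z))).
have G0 a : 0 <= G a by exact: integral_ge0.
have step a : \int[borel_lebesgue R n]_t
      (F (midpoint x (tuple_cons ((a : measurableTypeR R), t)))) =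
    (2 ^+ n)%:E * G (((tnth x ord0 : R) + a) / 2)%R.
  under eq_integral do rewrite midpoint_cons.
  apply: (IH _ (fun t => F (tuple_cons (_, t)))) => //.
  by apply: (measurableT_comp mFc); exact: measurable_fun_pair.
rewrite /fubini_F /=.
transitivity (\int[lebesgue_measure]_a
  ((2 ^+ n)%:E * G (((tnth x ord0 : R) + a) / 2)%R)).
  by apply: eq_integral => a _; exact: step.
have mGh : measurable_fun setT
    (fun a : measurableTypeR R => G (((tnth x ord0 : R) + a) / 2)%R).
  apply: (measurableT_comp mG).
  by apply: measurable_funM => //; exact: measurable_funD.
have pow2_ge0 : (0 <= 2 ^+ n :> R)%R by rewrite exprn_ge0.
rewrite (ge0_integralZl_EFin _ _ _ mGh pow2_ge0).
- by rewrite integral_midpoint1// muleA -EFinM -exprSr.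
- exact: measurableT.
- by move=> a _; exact: G0.
Qed.

End midpoint.

(** * Integrating a pointwise midpoint inequality over pairs of points *)

Section midpoint_inequality.
Local Open Scope ereal_scope.
Context {R : realType} {n : nat}.
Let m := borel_lebesgue R n.

Lemma integral_midpointr (H : Rn R n * Rn R n -> \bar R) :
  measurable_fun setT H -> (forall z, 0 <= H z) ->
  \int[m \x m]_z H (z.1, midpoint z.1 z.2) =
  (2 ^+ n)%:E * \int[m \x m]_z H z.
Proof.
move=> mH H0.
have mHmid : measurable_fun setT
    (fun z : Rn R n * Rn R n => H (z.1, midpoint z.1 z.2)).
  apply: (measurableT_comp mH); apply: measurable_fun_pair => //.
  exact: measurable_midpoint2.
have mHx (x : Rn R n) : measurable_fun setT (fun y => H (x, y)).
  by apply: (measurableT_comp mH); exact: measurable_fun_pair.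
have pow2_ge0 : (0 <= 2 ^+ n :> R)%R by rewrite exprn_ge0.
rewrite fubini_tonelli1// fubini_tonelli1// /fubini_F /=.
rewrite -(ge0_integralZl_EFin m measurableT _ _ pow2_ge0).
- by apply: eq_integral => x _; exact: (integral_midpoint x (mHx x)).
- by move=> x _; exact: integral_ge0.
- exact: (measurable_fun_fubini_tonelli_F (m2 := m) H).
Qed.

(** Here Tonelli integrates in [x] first, and the symmetry of the midpoint reduces to the
    substitution in the second argument. *)
Lemma integral_midpointl (H : Rn R n * Rn R n -> \bar R) :
  measurable_fun setT H -> (forall z, 0 <= H z) ->
  \int[m \x m]_z H (midpoint z.1 z.2, z.2) =
  (2 ^+ n)%:E * \int[m \x m]_z H z.
Proof.
move=> mH H0.
have mHmid : measurable_fun setT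
    (fun z : Rn R n * Rn R n => H (midpoint z.1 z.2, z.2)).
  apply: (measurableT_comp mH); apply: measurable_fun_pair => //.
  exact: measurable_midpoint2.
have mHy (y : Rn R n) : measurable_fun setT (fun x => H (x, y)).
  by apply: (measurableT_comp mH); exact: measurable_fun_pair.
have pow2_ge0 : (0 <= 2 ^+ n :> R)%R by rewrite exprn_ge0.
rewrite fubini_tonelli2// fubini_tonelli2// /fubini_G /=.
rewrite -(ge0_integralZl_EFin m measurableT _ _ pow2_ge0).
- apply: eq_integral => y _; rewrite -(integral_midpoint y (mHy y))//.
  by apply: eq_integral => x _; rewrite midpointC.
- by move=> y _; exact: integral_ge0.
- exact: (measurable_fun_fubini_tonelli_G (m1 := m) H).
Qed.

(** Each of the two half-pairs costs a factor [2 ^+ n], so together they cost [2 ^+ n.+1]. *)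
Lemma le_integral_midpoint (c : R) (G H : Rn R n * Rn R n -> \bar R) :
  (0 <= c)%R -> measurable_fun setT G -> measurable_fun setT H ->
  (forall z, 0 <= G z) -> (forall z, 0 <= H z) ->
  (forall x y, G (x, y) <=
    c%:E * (H (x, midpoint x y) + H (midpoint x y, y))) ->
  \int[m \x m]_z G z <= (c * 2 ^+ n.+1)%:E * \int[m \x m]_z H z.
Proof.
move=> c0 mG mH G0 H0 GH.
have mHr : measurable_fun setT
    (fun z : Rn R n * Rn R n => H (z.1, midpoint z.1 z.2)).
  apply: (measurableT_comp mH); apply: measurable_fun_pair => //.
  exact: measurable_midpoint2.
have mHl : measurable_fun setT
    (fun z : Rn R n * Rn R n => H (midpoint z.1 z.2, z.2)).
  apply: (measurableT_comp mH); apply: measurable_fun_pair => //.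
  exact: measurable_midpoint2.
pose S (z : Rn R n * Rn R n) :=
  H (z.1, midpoint z.1 z.2) + H (midpoint z.1 z.2, z.2).
have mS : measurable_fun setT S by exact: emeasurable_funD.
have S0 z : 0 <= S z by exact: adde_ge0.
apply: (@le_trans _ _ (\int[m \x m]_z (c%:E * S z))).
  apply: ge0_le_integral => //; first exact: measurable_funeM.
  by move=> [x y] _; exact: GH.
rewrite ge0_integralZl_EFin// /S ge0_integralD//.
rewrite integral_midpointl// integral_midpointr//.
have I0 : 0 <= \int[m \x m]_z H z by exact: integral_ge0.
rewrite -ge0_muleDl ?lee_fin ?exprn_ge0// -EFinD muleA -EFinM.
by rewrite exprS mulr_natl mulr2n.
Qed.

End midpoint_inequality.

(** * The truncated oscillation on dyadic shells around the diagonal *)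

Section shells.
Context {R : realType}.

Lemma powRD_le (p a b : R) : 1 <= p -> 0 <= a -> 0 <= b ->
  (a + b) `^ p <= 2 `^ (p - 1) * (a `^ p + b `^ p).
Proof.
move=> p1 a0 b0; have p0 : 0 <= p by exact: le_trans p1.
have half0 : 0 <= 2^-1 :> R by [].
have half1 : 2^-1 <= 1 :> R by rewrite invf_le1 ?ler1n.
have le_mid : (2^-1 * (a + b)) `^ p <= 2^-1 * (a `^ p + b `^ p).
  have := convex_powR p1 (Itv01 half0 half1) (x := a) (y := b).
  rewrite !inE/= !in_itv/= !andbT => /(_ a0 b0).
  have onem_half : 1 - 2^-1 = 2^-1 :> R by lra.
  rewrite convRE [X in X `^ _ <= _ -> _]convRE /= /unstable.onem onem_half.
  by rewrite -!mulrDr.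
rewrite powRM ?addr_ge0// -powR_inv1// -powRrM mulN1r in le_mid.
have -> : (a + b) `^ p = 2 `^ p * (2 `^ (- p) * (a + b) `^ p).
  by rewrite mulrA -powRD ?subrr ?powRr0 ?mul1r// pnatr_eq0 implybT.
rewrite powRB ?pnatr_eq0 ?implybT// powRr1// -mulrA ler_wpM2l ?powR_ge0//.
by rewrite powR_inv1 in le_mid.
Qed.

Context {n : nat}.
Implicit Types x y : Rn R n.

Lemma euclidean_dist_ge0 x y : 0 <= euclidean_dist x y.
Proof. exact: sqrtr_ge0. Qed.

Lemma euclidean_dist_eq0 x y : euclidean_dist x y = 0 -> x = y.
Proof.
move/eqP; rewrite sqrtr_eq0 => le0; apply: eq_from_tnth => i.
have /psumr_eq0P/(_ i isT)/eqP : \sum_(i < n)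
    ((tnth x i : R) - (tnth y i : R)) ^+ 2 = 0.
  by apply/le_anti; rewrite le0 sumr_ge0// => ? _; exact: sqr_ge0.
by rewrite sqrf_eq0 subr_eq0 => H; apply/eqP/H => j _; exact: sqr_ge0.
Qed.

Lemma euclidean_dist_midpointr x y :
  euclidean_dist x (midpoint x y) = euclidean_dist x y / 2.
Proof.
have half0 : 0 <= 2^-1 :> R by [].
rewrite /euclidean_dist -[in RHS](ger0_norm half0) -sqrtr_sqr -sqrtrM; last first.
  by apply: sumr_ge0 => i _; exact: sqr_ge0.
rewrite mulr_suml; congr Num.sqrt; apply: eq_bigr => i _.
by rewrite tnth_mktuple -exprMn; congr (_ ^+ 2); field.
Qed.

Lemma euclidean_dist_midpointl x y :
  euclidean_dist (midpoint x y) y = euclidean_dist x y / 2.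
Proof.
have half0 : 0 <= 2^-1 :> R by [].
rewrite /euclidean_dist -[in RHS](ger0_norm half0) -sqrtr_sqr -sqrtrM; last first.
  by apply: sumr_ge0 => i _; exact: sqr_ge0.
rewrite mulr_suml; congr Num.sqrt; apply: eq_bigr => i _.
by rewrite tnth_mktuple -exprMn; congr (_ ^+ 2); field.
Qed.

Lemma measurable_euclidean_dist : measurable_fun setT
  (fun z : Rn R n * Rn R n => euclidean_dist z.1 z.2).
Proof.
have mc i : measurable_fun setT (fun x : Rn R n => (tnth x i : R)).
  exact: (@measurable_tnth _ (measurableTypeR R)).
rewrite /euclidean_dist; under eq_fun do
  rewrite -powR12_sqrt ?(sumr_ge0 _ (fun _ _ => sqr_ge0 _))//.
apply: (measurableT_comp (@measurable_powR R _)).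
apply: measurable_sum => i; apply: measurable_funX; apply: measurable_funB.
- exact: (measurableT_comp (mc i)).
- exact: (measurableT_comp (mc i)).
Qed.

Variables (p : R) (p_ge1 : 1 <= p) (v : Rn R n -> R).

(* Subtracting [s * dist] keeps the midpoint inequality and forces the
   difference quotient to be at least [s / r `^ (n / p)] wherever the excess is
   positive, so that no localization in space is needed. *)
Definition shell_excess (s r : R) (z : Rn R n * Rn R n) : R :=
  if r / 2 < euclidean_dist z.1 z.2 <= r
  then Num.max 0 (`|v z.1 - v z.2| - s * euclidean_dist z.1 z.2) `^ p else 0.

Lemma shell_excess_ge0 s r z : 0 <= shell_excess s r z.
Proof. by rewrite /shell_excess; case: ifP => // _; exact: powR_ge0. Qed.

(** Both half-pairs are at half the distance, so they lie in the shell of radius [r / 2] exactly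
    when [(x, y)] lies in that of radius [r]. The term [s * d] splits evenly between them, so the
    triangle inequality survives the subtraction. *)
Lemma shell_excess_midpoint s r x y :
  shell_excess s r (x, y) <= 2 `^ (p - 1) *
    (shell_excess s (r / 2) (x, midpoint x y) +
     shell_excess s (r / 2) (midpoint x y, y)).
Proof.
rewrite /shell_excess /= euclidean_dist_midpointl euclidean_dist_midpointr.
set d := euclidean_dist x y.
rewrite !ltr_pM2r ?ler_pM2r//.
case: ifPn => _; last by rewrite addr0 mulr0.
set a := _ - _ * _; set b := _ - _ * _; set c := _ - _ * _.
have abc : a <= b + c.
  have := ler_distD (v (midpoint x y)) (v x) (v y).
  by rewrite /a /b /c; lra.
have p0 : 0 <= p by exact: le_trans p_ge1.
apply: (@le_trans _ _ ((Num.max 0 b + Num.max 0 c) `^ p)).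
  apply: ge0_ler_powR => //; rewrite ?nnegrE ?addr_ge0 ?le_max ?lexx//.
  rewrite ge_max addr_ge0 ?le_max ?lexx//=.
  by apply: le_trans abc _; rewrite lerD// le_max lexx orbT.
by apply: powRD_le => //; rewrite le_max lexx.
Qed.

Lemma measurable_shell_excess s r :
  measurable_fun setT v -> measurable_fun setT (shell_excess s r).
Proof.
move=> mv; have md := measurable_euclidean_dist.
apply: measurable_fun_ifT => //.
  rewrite (_ : (fun _ => _) = fun z : Rn R n * Rn R n =>
    (r / 2 < euclidean_dist z.1 z.2) && (euclidean_dist z.1 z.2 <= r))//.
  by apply: measurable_and; [exact: measurable_fun_ltr|exact: measurable_fun_ler].
apply: (measurableT_comp (@measurable_powR R _)).
apply: measurable_maxr => //; apply: measurable_funB; last exact: measurable_funM.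
apply: (measurableT_comp (f := Num.norm : R -> R)) => //.
by apply: measurable_funB; exact: measurableT_comp.
Qed.

Lemma dyadic_level (L t : R) J : 0 < L -> L <= t < L * 2 ^+ J ->
  exists2 j, (j < J)%N & L * 2 ^+ j <= t < L * 2 ^+ j.+1.
Proof.
move=> L0; elim: J => [|J IH] /andP[Lt tL].
  by move: tL; rewrite mulr1 ltNge Lt.
have [tJ|tJ] := ltP t (L * 2 ^+ J).
  by have [|j jJ] := IH; [rewrite Lt|exists j => //; exact: leqW].
by exists J => //; rewrite tJ.
Qed.

End shells.

(** * Pointwise comparison of the weighted shell sum with dyadic level sets *)

Section shell_sum.
Context {R : realType} {n : nat}.
Variables (p : R) (p_ge1 : 1 <= p) (v : Rn R n -> R).
Hypothesis v_osc : forall x y, `|v x - v y| <= 2.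
Variables (s r : R) (s_gt0 : 0 < s) (r_gt0 : 0 < r).

Let p_gt0 : 0 < p. Proof. exact: lt_le_trans p_ge1. Qed.

Lemma norm_diff_quotient (z : Rn R n * Rn R n) :
  `|diff_quotient p v z| =
  `|v z.1 - v z.2| / euclidean_dist z.1 z.2 `^ (n%:R / p + 1).
Proof. by rewrite /diff_quotient normrM normfV (ger0_norm (powR_ge0 _ _)). Qed.

Let L : R := s / r `^ (n%:R / p).

Lemma diff_quotient_ge (z : Rn R n * Rn R n) :
  let d := euclidean_dist z.1 z.2 in
  0 < d <= r -> s * d <= `|v z.1 - v z.2| -> L <= `|diff_quotient p v z|.
Proof.
move=> d /andP[d0 dr] sd; rewrite norm_diff_quotient -/d.
rewrite ler_pdivlMr ?powR_gt0//; apply: le_trans sd.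
rewrite powRD ?(gt_eqF d0) ?implybT// powRr1 ?(ltW d0)// mulrA ler_pM2r//.
rewrite /L -mulrA ler_piMr ?(ltW s_gt0)// mulrC ler_pdivrMr ?powR_gt0// mul1r.
apply: ge0_ler_powR => //; rewrite ?nnegrE ?(ltW d0) ?(ltW r_gt0)//.
by rewrite divr_ge0// ltW.
Qed.

(** The numerator is at most 2, and shrinking the distance from [r] to [r / 2 ^+ K] costs a factor
    of at most [2 ^+ (K * n.+1)], because [n / p + 1 <= n + 1]. The shift [c] absorbs what depends
    on [s] and [r] only, so the number of dyadic levels is affine in [K]. *)
Lemma diff_quotient_lt (c K : nat) (z : Rn R n * Rn R n) :
  2 <= L * 2 ^+ c * r `^ (n%:R / p + 1) ->
  r / 2 ^+ K < euclidean_dist z.1 z.2 ->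
  `|diff_quotient p v z| < L * 2 ^+ (K * n.+1 + c).
Proof.
move=> hc; set d := euclidean_dist _ _ => rd; rewrite norm_diff_quotient -/d.
have d0 : 0 < d by apply: le_lt_trans rd; rewrite divr_ge0 ?exprn_ge0// ltW.
have e0 : 0 < n%:R / p + 1 by rewrite ltr_wpDl// divr_ge0// ltW.
rewrite ltr_pdivrMr ?powR_gt0//.
apply: le_lt_trans (v_osc _ _) _; apply: le_lt_trans hc _.
have L0 : 0 < L by rewrite divr_gt0// powR_gt0.
have -> : L * 2 ^+ (K * n.+1 + c) * d `^ (n%:R / p + 1) =
    L * 2 ^+ c * (2 ^+ (K * n.+1) * d `^ (n%:R / p + 1)) by rewrite exprD; ring.
rewrite ltr_pM2l; last by rewrite mulr_gt0// exprn_gt0.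
have K1 : 1 <= 2 ^+ K :> R by rewrite exprn_ege1// ler1n.
apply: (@lt_le_trans _ _ ((2 ^+ K * d) `^ (n%:R / p + 1))).
  rewrite gt0_ltr_powR// ?nnegrE ?mulr_ge0 ?exprn_ge0 ?(ltW d0) ?(ltW r_gt0)//.
  by rewrite mulrC -ltr_pdivrMr// exprn_gt0.
rewrite powRM ?exprn_ge0 ?(ltW d0)// ler_wpM2r ?powR_ge0//.
rewrite exprM -[(2 ^+ K) ^+ n.+1]powR_mulrn ?exprn_ge0//; apply: ler_powR => //.
rewrite -natr1 lerD2r ler_pdivrMr// ler_peMr//.
Qed.

(** On the k-th shell [2 ^+ k <= r / d], and [|v x - v y|]^
    p[is the p-th power of the quotient times]d [^ (n + p)]; the powers of [d] cancel. *)
Lemma shell_excess_le k (z : Rn R n * Rn R n) :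
  (2 `^ (n%:R + p)) ^+ k * shell_excess p v s (r / 2 ^+ k) z <=
  r `^ (n%:R + p) * `|diff_quotient p v z| `^ p.
Proof.
rewrite /shell_excess; set d := euclidean_dist _ _.
case: ifPn => [/andP[rd dr]|_]; last by rewrite mulr0 mulr_ge0 ?powR_ge0.
have d0 : 0 < d.
  by apply: le_lt_trans rd; rewrite !divr_ge0 ?exprn_ge0// ltW.
have np0 : 0 <= n%:R + p by rewrite addr_ge0// ltW.
have -> : (2 `^ (n%:R + p)) ^+ k = (2 ^+ k) `^ (n%:R + p).
  by rewrite -powR_mulrn ?powR_ge0// -[in RHS]powR_mulrn// -!powRrM mulrC.
have -> : r `^ (n%:R + p) * `|diff_quotient p v z| `^ p =
    (r / d) `^ (n%:R + p) * `|v z.1 - v z.2| `^ p.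
  have dp : (d `^ (n%:R / p + 1)) `^ p = d `^ (n%:R + p).
    by rewrite -powRrM mulrDl mul1r divfK ?(gt_eqF p_gt0).
  have rd_split : r `^ (n%:R + p) = (r / d) `^ (n%:R + p) * d `^ (n%:R + p).
    by rewrite -powRM ?divr_ge0 ?(ltW d0) ?(ltW r_gt0)// divfK ?gt_eqF.
  have -> : `|v z.1 - v z.2| =
      `|diff_quotient p v z| * d `^ (n%:R / p + 1).
    by rewrite norm_diff_quotient -/d divfK// gt_eqF// powR_gt0.
  by rewrite [in RHS](powRM _ (normr_ge0 _) (powR_ge0 _ _)) dp rd_split; ring.
apply: ler_pM; rewrite ?powR_ge0//.
  apply: ge0_ler_powR => //; rewrite ?nnegrE ?divr_ge0 ?exprn_ge0 ?(ltW d0) ?(ltW r_gt0)//.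
  by rewrite ler_pdivlMr// mulrC -ler_pdivlMr// exprn_gt0.
apply: ge0_ler_powR; rewrite ?nnegrE ?le_max ?lexx ?(ltW p_gt0)//.
by rewrite ge_max normr_ge0 /= gerBl mulr_ge0 ?ltW.
Qed.

(** The shells are disjoint, so at most one term on the left is nonzero. The quotient then lies in a
    single dyadic band [[L 2^j, L 2^(j+1))], and the j-th term on the right alone dominates. *)
Lemma shell_excess_sum_le (c K : nat) (z : Rn R n * Rn R n) :
  2 <= L * 2 ^+ c * r `^ (n%:R / p + 1) ->
  \sum_(k < K) (2 `^ (n%:R + p)) ^+ k * shell_excess p v s (r / 2 ^+ k) z <=
  r `^ (n%:R + p) * \sum_(j < K * n.+1 + c)
    (L * 2 ^+ j.+1) `^ p * \1_[set z | L * 2 ^+ j <= `|diff_quotient p v z|] z.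
Proof.
move=> hc; set d := euclidean_dist z.1 z.2.
have term0 (j : nat) : 0 <= (L * 2 ^+ j.+1) `^ p *
    \1_[set z | L * 2 ^+ j <= `|diff_quotient p v z|] z.
  by rewrite mulr_ge0// ?powR_ge0// indicE.
have [[k [/andP[rd dr] sd]]|nok] := pselect (exists k : 'I_K,
    r / 2 ^+ k / 2 < d <= r / 2 ^+ k /\ s * d < `|v z.1 - v z.2|); last first.
  (* Without such a shell every term is 0: either [z] is outside the shell or the positive part
     vanishes, and 0 to the positive power [p] is 0. *)
  rewrite big1 => [|k _]; first by rewrite mulr_ge0 ?powR_ge0 ?sumr_ge0.
  rewrite /shell_excess; case: ifPn => [dk|_]; last by rewrite mulr0.
  rewrite -/d max_l ?powR0 ?mulr0 ?gt_eqF// subr_le0 leNgt.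
  by apply/negP => sd; apply: nok; exists k.
have pow2_gt0 m : 0 < 2 ^+ m :> R by rewrite exprn_gt0.
rewrite (bigD1 k)//= big1 ?addr0; last first.
  move=> i ik; rewrite /shell_excess -/d; case: ifPn => [/andP[rdi dri]|_];
    last by rewrite mulr0.
  have shell_disj (a b : nat) : (a < b)%N -> r / 2 ^+ a / 2 < d ->
      d <= r / 2 ^+ b -> false.
    move=> ab ra db; have := lt_le_trans ra db.
    rewrite -mulrA -invfM -exprSr ltr_pM2l// ltf_pV2 ?posrE// ltNge.
    by rewrite ler_eXn2l ?ltr1n// ab.
  have : (i < k)%N || (k < i)%N.
    by rewrite -neq_ltn; apply: contra ik => /eqP ik; apply/eqP/val_inj.
  by case/orP => [ik'|ki]; [have := shell_disj _ _ ik' rdi dr|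
                            have := shell_disj _ _ ki rd dri].
apply: (le_trans (shell_excess_le k z)).
rewrite ler_wpM2l ?powR_ge0//.
have d0 : 0 < d by apply: le_lt_trans rd; rewrite !divr_ge0 ?ltW.
have L0 : 0 < L by rewrite divr_gt0// powR_gt0.
(* As [k < K], the inner radius of the k-th shell is at least [r / 2 ^+ K]. *)
have Lf : L <= `|diff_quotient p v z| < L * 2 ^+ (K * n.+1 + c).
  rewrite diff_quotient_ge ?(ltW sd)//=; last first.
    rewrite d0 (le_trans dr)// ler_pdivrMr// ler_peMr ?(ltW r_gt0)//.
    by rewrite exprn_ege1// ler1n.
  apply: diff_quotient_lt => //; apply: le_lt_trans rd.
  rewrite -mulrA -invfM -exprSr ler_pM2l// lef_pV2 ?posrE//.
  by rewrite ler_eXn2l// ?ltr1n.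
have [j jJ /andP[Lj jL]] := dyadic_level L0 Lf.
rewrite (bigD1 (Ordinal jJ))//= indicE mem_set//= mulr1.
apply: ler_wpDr; first exact: sumr_ge0.
apply: ge0_ler_powR; rewrite ?nnegrE ?(ltW p_gt0) ?(ltW jL)//.
by rewrite mulr_ge0 ?(ltW L0) ?exprn_ge0.
Qed.

End shell_sum.

(** * Doubling inequality for the shell integrals and its summation *)

Section shell_integral.
Local Open Scope ereal_scope.
Context {R : realType} {n : nat}.
Let m := borel_lebesgue R n.
Variables (p : R) (p_ge1 : (1 <= p)%R) (v : Rn R n -> R).
Hypothesis v_osc : forall x y, (`|v x - v y| <= 2)%R.
Hypothesis mv : measurable_fun setT v.

Let p_gt0 : (0 < p)%R. Proof. exact: lt_le_trans p_ge1. Qed.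

Lemma measurable_diff_quotient : measurable_fun setT (diff_quotient p v).
Proof.
apply: measurable_funM.
  by apply: measurable_funB; exact: measurableT_comp.
rewrite (_ : (fun _ => _) =
    fun z => euclidean_dist z.1 z.2 `^ (- (n%:R / p + 1)))%R; last first.
  by apply/funext => z; rewrite powRN.
apply: (measurableT_comp (@measurable_powR R _)).
exact: measurable_euclidean_dist.
Qed.

Lemma measurable_diff_quotient_ge (l : R) :
  measurable [set z | (l <= `|diff_quotient p v z|)%R].
Proof.
rewrite (_ : [set _ | _] = (Num.norm \o diff_quotient p v) @^-1` `[l, +oo[).
  rewrite -[X in measurable X]setTI.
  have mq : measurable_fun setT (Num.norm \o diff_quotient p v).
    by apply: measurableT_comp => //; exact: measurable_diff_quotient.
  exact: mq.
by apply/seteqP; split => z /=; rewrite in_itv/= andbT.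
Qed.

Definition shell_integral (s r : R) : \bar R :=
  \int[m \x m]_z (shell_excess p v s r z)%:E.

(** One midpoint step costs [2]^ (p - 1)[from convexity times]2 ^+
    n.+1[from the substitution, that is]2 [^ (n + p)]; this is iterated [k] times. *)
Lemma shell_integral_double s r k : shell_integral s r <=
  ((2 `^ (n%:R + p)) ^+ k)%:E * shell_integral s (r / 2 ^+ k).
Proof.
have step r' : shell_integral s r' <=
    (2 `^ (n%:R + p))%:E * shell_integral s (r' / 2).
  have -> : (2 `^ (n%:R + p) = 2 `^ (p - 1) * 2 ^+ n.+1 :> R)%R.
    rewrite -powR_mulrn// -powRD ?pnatr_eq0 ?implybT//.
    by congr (_ `^ _)%R; rewrite -natr1; ring.
  apply: le_integral_midpoint.
  - exact: powR_ge0.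
  - by apply/measurable_EFinP; exact: measurable_shell_excess.
  - by apply/measurable_EFinP; exact: measurable_shell_excess.
  - by move=> z; rewrite lee_fin shell_excess_ge0.
  - by move=> z; rewrite lee_fin shell_excess_ge0.
  - by move=> x y; rewrite lee_fin; exact: shell_excess_midpoint.
elim: k => [|k IH]; first by rewrite !expr0 divr1 mul1e.
apply: le_trans IH _.
rewrite exprSr EFinM -muleA; apply: lee_wpmul2l.
  by rewrite lee_fin exprn_ge0// powR_ge0.
by apply: le_trans (step _) _; rewrite -mulrA -invfM -exprSr.
Qed.

Lemma shell_integral_sum_le (s r : R) (c K : nat) : (0 < s)%R -> (0 < r)%R ->
  let L := (s / r `^ (n%:R / p))%R in
  (2 <= L * 2 ^+ c * r `^ (n%:R / p + 1))%R ->
  K%:R%:E * shell_integral s r <= (r `^ (n%:R + p) * 2 `^ p)%:E *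
    \sum_(j < K * n.+1 + c) (((L * 2 ^+ j) `^ p)%:E *
      (m \x m) [set z | (L * 2 ^+ j <= `|diff_quotient p v z|)%R]).
Proof.
move=> s0 r0 L hc; have L0 : (0 < L)%R by rewrite divr_gt0// powR_gt0.
have mse r' : measurable_fun setT (fun z => (shell_excess p v s r' z)%:E).
  by apply/measurable_EFinP; exact: measurable_shell_excess.
pose level j := [set z | (L * 2 ^+ j <= `|diff_quotient p v z|)%R].
have mlevel j : measurable (level j) by exact: measurable_diff_quotient_ge.
have D0 : (0 <= 2 `^ (n%:R + p) :> R)%R by exact: powR_ge0.
apply: (@le_trans _ _ (\int[m \x m]_z
    (\sum_(k < K) ((2 `^ (n%:R + p)) ^+ k * shell_excess p v s (r / 2 ^+ k) z)%:E))).
  rewrite ge0_integral_sum//; last 2 first.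
  - move=> k; under eq_fun do rewrite EFinM.
    exact: measurable_funeM.
  - by move=> k z _; rewrite lee_fin mulr_ge0 ?exprn_ge0 ?shell_excess_ge0.
  have -> : K%:R%:E * shell_integral s r = \sum_(k < K) shell_integral s r.
    by rewrite mule_natl big_const_ord iter_addr addr0.
  apply: lee_sum => k _; apply: le_trans (shell_integral_double s r k) _.
  under eq_integral do rewrite EFinM.
  rewrite ge0_integralZl_EFin// ?exprn_ge0//.
  by move=> z _; rewrite lee_fin shell_excess_ge0.
apply: (@le_trans _ _ (\int[m \x m]_z \sum_(j < K * n.+1 + c)
    ((r `^ (n%:R + p) * (L * 2 ^+ j.+1) `^ p) * \1_(level j) z)%:E)).
  apply: ge0_le_integral => //.
  - by move=> z _; apply: sume_ge0 => k _;
      rewrite lee_fin mulr_ge0 ?exprn_ge0 ?shell_excess_ge0.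
  - apply: emeasurable_sum => k; under eq_fun do rewrite EFinM.
    exact: measurable_funeM.
  - apply: emeasurable_sum => j; apply/measurable_EFinP.
    by apply: measurable_funM => //; exact: measurable_indic.
  - move=> z _; rewrite !sumEFin lee_fin.
    under [leRHS]eq_bigr do rewrite -mulrA.
    by rewrite -mulr_sumr; exact: shell_excess_sum_le.
rewrite ge0_integral_sum//; last 2 first.
- move=> j; apply/measurable_EFinP.
  by apply: measurable_funM => //; exact: measurable_indic.
- by move=> j z _; rewrite lee_fin mulr_ge0// mulr_ge0 ?powR_ge0.
rewrite ge0_sume_distrr; last first.
  by move=> j _; rewrite mule_ge0// lee_fin powR_ge0.
apply: lee_sum => j _; under eq_integral do rewrite EFinM.
rewrite ge0_integralZl_EFin//; last 2 first.
- by apply/measurable_EFinP; exact: measurable_indic.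
- by rewrite mulr_ge0 ?powR_ge0.
rewrite integral_indic// setIT muleA -EFinM.
have -> : (r `^ (n%:R + p) * (L * 2 ^+ j.+1) `^ p =
    r `^ (n%:R + p) * 2 `^ p * (L * 2 ^+ j) `^ p)%R.
  have L2_ge0 : (0 <= L * 2 ^+ j)%R by rewrite mulr_ge0 ?exprn_ge0 ?(ltW L0).
  rewrite exprSr mulrA [((L * _ * _) `^ _)%R]powRM//.
  by rewrite -mulrA [((L * _) `^ _ * _)%R]mulrC.
exact: lexx.
Qed.

End shell_integral.

(** * Decay of level-set measures, and a Cesaro argument *)

Section vanishing.
Local Open Scope ereal_scope.
Context {R : realType}.

Lemma sum_eventually_small (a : nat -> R) (e : R) (J : nat) :
  (0 <= e)%R -> (forall j, 0 <= a j)%R -> (forall j, (J <= j)%N -> a j <= e)%R ->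
  forall M, (\sum_(j < M) a j <= \sum_(j < J) a j + M%:R * e)%R.
Proof.
move=> e0 a0 ae; elim=> [|M IH].
  by rewrite big_ord0 mul0r addr0 sumr_ge0.
have [JM|MJ] := leqP J M.
  by rewrite big_ord_recr/= -natr1 mulrDl mul1r addrA lerD// ae.
apply: ler_wpDr; first by rewrite mulr_ge0.
rewrite -!(big_mkord xpredT) [in leRHS](big_cat_nat (leq0n _) MJ)//=.
by rewrite lerDl sumr_ge0.
Qed.

(** The sum has O(K) terms that become arbitrarily small, so it is o(K), while the left side grows
    linearly in [K] unless [I] is 0. *)
Lemma cesaro_vanish (a : nat -> \bar R) (I : \bar R) (C : R) (b c : nat) :
  (0 <= C)%R -> 0 <= I -> (forall j, 0 <= a j) -> (forall j, a j < +oo) ->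
  (forall e : R, (0 < e)%R ->
     exists J, forall j, (J <= j)%N -> a j <= e%:E) ->
  (forall K, K%:R%:E * I <= C%:E * \sum_(j < K * b + c) a j) ->
  I = 0.
Proof.
move=> C0 I0 a0 aoo asmall IK.
have aE j : a j = (fine (a j))%:E by rewrite fineK// ge0_fin_numE.
have IKr K : K%:R%:E * I <= (C * \sum_(j < K * b + c) fine (a j))%:E.
  rewrite EFinM -sumEFin; under [X in _ <= _ * X]eq_bigr do rewrite -aE.
  exact: IK.
(* The case [K = 1] bounds [I] by a finite quantity. *)
have Ifin : I \is a fin_num.
  by rewrite ge0_fin_numE//; apply: le_lt_trans (ltry _); have := IKr 1%N; rewrite mul1e; exact.
rewrite -(fineK Ifin); congr EFin; apply/eqP; rewrite eq_le fine_ge0// andbT.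
have {}IKr (K : nat) : (K%:R * fine I <= C * \sum_(j < K * b + c) fine (a j))%R.
  by rewrite -lee_fin EFinM fineK.
rewrite leNgt; apply/negP => x0; set x := fine I in x0 IKr.
have Cb0 : (0 < C * b%:R + 1)%R by rewrite ltr_wpDl// mulr_ge0.
(* Chosen so that [C * b * e <= x / 2]; the added 1 keeps the denominator positive. *)
pose e := (x / 2 / (C * b%:R + 1))%R.
have e0 : (0 < e)%R by rewrite !divr_gt0.
have [J Jsmall] := asmall e e0.
have a0' j : (0 <= fine (a j))%R by rewrite fine_ge0.
have ae' j : (J <= j)%N -> (fine (a j) <= e)%R.
  by move=> Jj; rewrite -lee_fin -aE Jsmall.
have bound := sum_eventually_small (ltW e0) a0' ae'.
set B := (\sum_(j < J) fine (a j))%R in bound.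
(* Beyond this threshold the remaining half [K * x / 2] exceeds the part of the bound that is
   independent of [K]. *)
pose Y := (C * (B + c%:R * e) / (x / 2))%R.
pose K := (Num.truncn Y).+1.
have YK : (Y < K%:R)%R by exact: truncnS_gt.
have : (K%:R * x <= C * (B + (K * b + c)%:R * e))%R.
  by apply: le_trans (IKr K) _; rewrite ler_wpM2l.
apply/negP; rewrite -ltNge natrD natrM.
have ex : (C * b%:R * e <= x / 2)%R.
  by rewrite mulrCA ler_piMr ?divr_ge0 ?(ltW x0)// ler_pdivrMr// mul1r lerDl.
rewrite /Y ltr_pdivrMr ?divr_gt0// in YK.
have K0 : (0 <= K%:R :> R)%R by [].
have := ler_wpM2l K0 ex.
lra.
Qed.

(** The superlevel sets are intervals. *)
Lemma measurable_nonincreasing (M : R -> \bar R) :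
  (forall x y, (x <= y)%R -> M y <= M x) -> measurable_fun setT M.
Proof.
move=> Mle; apply: (measurability _ (ErealGenOInfty.measurableE R)).
move=> _ [_ [r ->] <-]; rewrite setTI; apply: is_interval_measurable.
move=> x y /=; rewrite !in_itv/= !andbT => _ ry z /andP[_ zy].
by rewrite in_itv/= andbT; apply: lt_le_trans ry _; exact: Mle.
Qed.

(** By monotonicity of [M], the integral over the dyadic interval ending at [l_ j] dominates a
    constant times [((l_ j)]^ p * M (l_ j)) [^ (q / p)]. These integrals have a finite sum, so each
    is finite and they tend to 0. *)
Lemma lorentz_level_vanish (M : R -> \bar R) (p q L : R) :
  (1 <= p)%R -> (1 <= q)%R -> (0 < L)%R -> (forall l, 0 <= M l) ->
  (forall x y, (x <= y)%R -> M y <= M x) ->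
  \int[lebesgue_measure]_(l in `]0%R, +oo[)
     ((l `^ q)%:E * M l `^ (q / p) * (l^-1)%:E) < +oo ->
  (forall j, M (L * 2 ^+ j)%R < +oo) /\
  (forall e : R, (0 < e)%R -> exists J, forall j, (J <= j)%N ->
    ((L * 2 ^+ j) `^ p)%:E * M (L * 2 ^+ j)%R <= e%:E).
Proof.
move=> p1 q1 L0 M0 Mle.
have p0 : (0 < p)%R by exact: lt_le_trans p1.
have q0 : (0 < q)%R by exact: lt_le_trans q1.
have qp0 : (0 < q / p)%R by rewrite divr_gt0.
pose H (l : R) := (l `^ q)%:E * M l `^ (q / p) * (l^-1)%:E.
pose l_ j : R := (L * 2 ^+ j)%R.
have l_gt0 j : (0 < l_ j)%R by rewrite mulr_gt0// exprn_gt0.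
pose F j : set (measurableTypeR R) := `](l_ j / 2)%R, l_ j]%classic.
have F_gt0 j l : F j l -> (0 < l)%R.
  by rewrite /F/= in_itv/= => /andP[+ _]; apply: lt_trans; rewrite divr_gt0.
have mF j : measurable (F j) by exact: measurable_itv.
have mH : measurable_fun (`]0%R, +oo[%classic : set (measurableTypeR R)) H.
  rewrite /H; apply: emeasurable_funM; first apply: emeasurable_funM.
  - by apply: measurable_funTS; apply/measurable_EFinP; exact: measurable_powR.
  - apply: measurable_funTS.
    by apply: (measurableT_comp (@measurable_poweR R _)); exact: measurable_nonincreasing.
  (* The inverse is the power -1 on the positive half-line, which contains the domain of
     integration. *)
  - apply/measurable_EFinP; apply: (eq_measurable_fun (fun l : R => l `^ (-1))%R).
      by move=> l; rewrite inE/= in_itv/= andbT => /ltW l0; rewrite powR_inv1.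
    by apply: measurable_funTS; exact: measurable_powR.
have H0 l : (0 < l)%R -> 0 <= H l.
  move=> l0; rewrite mule_ge0 ?lee_fin ?invr_ge0 ?(ltW l0)//.
  by rewrite mule_ge0 ?lee_fin ?powR_ge0 ?poweR_ge0.
move=> Hoo.
have FS : \bigcup_j F j `<=` (`]0%R, +oo[%classic : set (measurableTypeR R)).
  by move=> l [j _ /F_gt0 l0]; rewrite /= in_itv/= l0.
have tF : trivIset setT F.
  apply/trivIsetP => i j _ _.
  wlog ij : i j / (i < j)%N.
    by move=> W; rewrite neq_ltn => /orP[|] lt;
      [apply: W|rewrite setIC; apply: W] => //; rewrite neq_ltn lt ?orbT.
  move=> _; apply/seteqP; split => // l []; rewrite /F/= !in_itv/=.
  move=> /andP[_ li] /andP[jl _]; have := lt_le_trans jl li; rewrite ltNge => /negP; apply.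
  rewrite ler_pdivlMr// -mulrA -exprSr ler_pM2l// ler_eXn2l// ltr1n//.
pose c j := \int[lebesgue_measure]_(l in F j) H l.
have c0 j : 0 <= c j by apply: integral_ge0 => l /F_gt0; exact: H0.
have csum : \sum_(0 <= j <oo) c j < +oo.
  apply: le_lt_trans Hoo.
  rewrite -ge0_integral_bigcup//.
  - apply: ge0_subset_integral => //; first exact: bigcupT_measurable.
    by move=> l; rewrite /= in_itv/= andbT; exact: H0.
  - exact: measurable_funS mH.
  - by move=> l /FS; rewrite /= in_itv/= andbT; exact: H0.
have cge j : (2 `^ (- q))%:E * (((l_ j) `^ p)%:E * M (l_ j)) `^ (q / p) <= c j.
  have hl0 : (0 < l_ j / 2)%R by rewrite divr_gt0.
  have muF : lebesgue_measure (F j) = (l_ j / 2)%:E.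
    rewrite /F lebesgue_measure_itv/= lte_fin ltr_pdivrMr// ltr_pMr// ltr1n.
    by rewrite -EFinB; congr EFin; field.
  have -> : (2 `^ (- q))%:E * (((l_ j) `^ p)%:E * M (l_ j)) `^ (q / p) =
     \int[lebesgue_measure]_(l in F j)
       (((l_ j / 2) `^ (q - 1))%:E * M (l_ j) `^ (q / p)).
    transitivity (((l_ j / 2) `^ (q - 1))%:E * M (l_ j) `^ (q / p) * (l_ j / 2)%:E).
      rewrite poweRM ?lee_fin ?powR_ge0// poweR_EFin -powRrM mulrCA.
      rewrite divff ?(gt_eqF p0)// mulr1 muleA -EFinM muleAC -EFinM.
      congr (_%:E * _); rewrite [RHS]mulrC mulr_powRB1 ?(ltW hl0)//.
      by rewrite powRM ?(ltW (l_gt0 j))// -powR_inv1// -powRrM mulN1r mulrC.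
    by rewrite -muF -(integral_cst _ (mF j)).
  apply: ge0_le_integral => //.
  - by move=> l _; rewrite mule_ge0 ?poweR_ge0 ?lee_fin ?powR_ge0.
  - by apply: measurable_funS mH => // l /F_gt0; rewrite /= in_itv/= => ->.
  - move=> l Fl; have l0 := F_gt0 _ _ Fl; rewrite /H muleAC -EFinM.
    move: Fl; rewrite /F/= in_itv/= => /andP[jl lj].
    apply: lee_pmul; rewrite ?lee_fin ?powR_ge0 ?poweR_ge0//.
      rewrite -[in leRHS](powR_inv1 (ltW l0)) -powRD ?(gt_eqF l0) ?implybT//.
      by apply: ge0_ler_powR; rewrite ?nnegrE ?subr_ge0// ?(ltW l0) ?(ltW hl0) ?(ltW jl).
    apply: gt0_ler_poweR; rewrite ?in_itv/= ?M0 ?leey ?(ltW qp0)//.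
    exact: Mle.
have powq_gt0 : 0 < (2 `^ (- q))%:E :> \bar R by rewrite lte_fin powR_gt0.
split.
  move=> j; have cj : c j < +oo.
    apply: le_lt_trans csum.
    by rewrite (@nneseriesD1 _ _ j xpredT)//= leeDl// nneseries_ge0.
  have := le_lt_trans (cge j) cj.
  rewrite -/(l_ j) => fin; rewrite ltey; apply/eqP => Moo; move: fin.
  rewrite Moo gt0_muley ?lte_fin ?powR_gt0// poweRyr ?(gt_eqF qp0)//.
  by rewrite gt0_muley.
move=> e e0.
have ctail : \sum_(N <= k <oo) c k @[N --> \oo] --> 0.
  exact: (@nneseries_tail_cvg _ _ xpredT).
(* The lower bound on [c j] that a value above [e] at level [j] would force; the tail sum starting
   at [j] falls below it. *)
pose d : R := (2 `^ (- q) * e `^ (q / p))%R.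
have d0 : (0 < d)%R by rewrite mulr_gt0 ?powR_gt0.
have [J _ Jd] : \forall N \near \oo, \sum_(N <= k <oo) c k < d%:E.
  have d0' : 0 < d%:E by rewrite lte_fin.
  exact: (ctail _ (open_ereal_lt' d0')).
exists J => j Jj; rewrite leNgt; apply/negP => elt.
have := Jd _ Jj; apply/negP; rewrite -leNgt.
apply: (@le_trans _ _ (c j)).
  apply: le_trans (cge j); rewrite EFinM lee_pmul2l// -(poweR_EFin e).
  apply: gt0_ler_poweR; rewrite ?in_itv/= ?leey ?andbT ?lee_fin ?(ltW e0) ?(ltW qp0)//.
    by rewrite mule_ge0 ?lee_fin ?powR_ge0.
  exact: ltW.
have -> : \sum_(j <= k <oo) c k = c j + \sum_(j.+1 <= k <oo) c k.
  by rewrite (nneseries_split _ 1)// addn1 big_nat1.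
by rewrite leeDl// nneseries_ge0.
Qed.

End vanishing.

(** * From vanishing shell integrals to almost everywhere constancy *)

Section constancy.
Local Open Scope ereal_scope.
Context {R : realType} {n : nat}.
Let m := borel_lebesgue R n.

Lemma integral0_negligible d (T : measurableType d)
    (mu : {measure set T -> \bar R}) (f : T -> R) :
  measurable_fun setT f -> (forall x, (0 <= f x)%R) ->
  \int[mu]_x (f x)%:E = 0 -> mu.-negligible [set x | (0 < f x)%R].
Proof.
move=> mf f0 If0.
have mEf : measurable_fun setT (EFin \o f) by exact/measurable_EFinP.
have := (ae_eq_integral_abs mu measurableT mEf).1.
rewrite (_ : \int[mu]_x _ = 0); last first.
  by rewrite -[RHS]If0; apply: eq_integral => x _ /=; rewrite ger0_norm.
move=> /(_ erefl); apply: negligibleS => x /= fx; apply/not_implyP; split => //.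
by move=> [fx0]; move: fx; rewrite fx0 ltxx.
Qed.

Lemma shell_integral_eq0 (p : R) (v : Rn R n -> R) (s r : R) :
  (1 <= p)%R -> measurable_fun setT v ->
  (forall x y, (`|v x - v y| <= 2)%R) -> (0 < s)%R -> (0 < r)%R ->
  (forall L : R, (0 < L)%R -> let a j := ((L * 2 ^+ j) `^ p)%:E *
      (m \x m) [set z | (L * 2 ^+ j <= `|diff_quotient p v z|)%R] in
    (forall j, a j < +oo) /\
    forall e : R, (0 < e)%R -> exists J, forall j, (J <= j)%N -> a j <= e%:E) ->
  shell_integral p v s r = 0.
Proof.
move=> p1 mv v_osc s0 r0 Hv.
pose L := (s / r `^ (n%:R / p))%R.
have L0 : (0 < L)%R by rewrite divr_gt0// powR_gt0.
pose a j := ((L * 2 ^+ j) `^ p)%:E *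
  (m \x m) [set z | (L * 2 ^+ j <= `|diff_quotient p v z|)%R].
have [aoo asmall] : (forall j, a j < +oo) /\
    forall e : R, (0 < e)%R -> exists J, forall j, (J <= j)%N -> a j <= e%:E.
  exact: Hv L0.
pose y := (2 / (L * r `^ (n%:R / p + 1)))%R.
(* An integer above [y], so that [2 ^+ c > c > y]. *)
pose c := (Num.truncn y).+1.
have hc : (2 <= L * 2 ^+ c * r `^ (n%:R / p + 1))%R.
  have Lr0 := mulr_gt0 L0 (powR_gt0 (n%:R / p + 1) r0).
  rewrite mulrAC mulrC -ler_pdivrMr//.
  apply: ltW; apply: lt_le_trans (truncnS_gt y) _.
  by rewrite -natrX ler_nat ltnW// ltn_expl.
apply: (@cesaro_vanish _ a _ (r `^ (n%:R + p) * 2 `^ p)%R n.+1 c) => //.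
- by rewrite mulr_ge0 ?powR_ge0.
- by apply: integral_ge0 => z _; rewrite lee_fin shell_excess_ge0.
- by move=> j; rewrite mule_ge0 ?lee_fin ?powR_ge0.
- by move=> K; exact: shell_integral_sum_le.
Qed.

(** Countably many slopes [s] and rational radii [r] suffice: every pair with [v x <> v y] has
    positive excess for one of them. *)
Lemma negligible_osc (p : R) (v : Rn R n -> R) : measurable_fun setT v ->
  (forall s r, (0 < s)%R -> (0 < r)%R ->
    shell_integral p v s r = 0) ->
  (m \x m).-negligible [set z | v z.1 <> v z.2].
Proof.
move=> mv I0.
pose s_ (i : nat) : R := (i.+1%:R^-1)%R.
pose r_ (a b : nat) : R := (a.+1%:R / b.+1%:R)%R.
apply: (@negligibleS _ _ _ _ (\bigcup_i \bigcup_a \bigcup_b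
    [set z | (0 < shell_excess p v (s_ i) (r_ a b) z)%R])); last first.
  do 3 (apply: negligible_bigcup => ?).
  apply: integral0_negligible.
  - exact: measurable_shell_excess.
  - by move=> z; exact: shell_excess_ge0.
  - by apply: I0; rewrite ?invr_gt0 ?divr_gt0.
move=> z /= /eqP vz; set d := euclidean_dist z.1 z.2.
have d0 : (0 < d)%R.
  rewrite lt_neqAle euclidean_dist_ge0 andbT eq_sym.
  by apply: contra_neq vz => /euclidean_dist_eq0 ->.
set t := `|v z.1 - v z.2|%R.
have t0 : (0 < t)%R by rewrite normr_gt0 subr_eq0.
(* Then [1 / (b + 1) < d], and [r = (a + 1) / (b + 1)] satisfies [d <= r <= d + 1 / (b + 1) < 2 d].
   Next, [i = truncn (d / t)] gives [s * d < t] for the slope [s = 1 / (i + 1)]. *)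
pose b := Num.truncn d^-1; pose a := Num.truncn (d * b.+1%:R).
exists (Num.truncn (d / t)) => //; exists a => //; exists b => //=.
have db : (1 < d * b.+1%:R)%R.
  by rewrite mulrC -ltr_pdivrMr// mul1r; exact: truncnS_gt.
have /truncn_itv/andP[ad da] : (0 <= d * b.+1%:R)%R by rewrite mulr_ge0// ltW.
rewrite /shell_excess -/d -/t ifT; last first.
  rewrite /r_ mulrAC ltr_pdivrMr// ler_pdivlMr// (ltW da) andbT.
  by rewrite ltr_pdivrMr// -natr1; lra.
rewrite powR_gt0// lt_max subr_gt0 /s_ orbC mulrC ltr_pdivrMr// mulrC.
by rewrite -ltr_pdivrMr// truncnS_gt.
Qed.

(** By Tonelli almost every section of the set of pairs with distinct values is null; the value of
    [v] at one such base point is the constant. *)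
Lemma ae_constant_of_negligible (v : Rn R n -> R) : measurable_fun setT v ->
  (m \x m).-negligible [set z | v z.1 <> v z.2] ->
  exists c, m [set x | v x <> c] = 0.
Proof.
move=> mv v_neg.
have mneq d' (T : measurableType d') (f g : T -> R) : measurable_fun setT f ->
    measurable_fun setT g -> measurable [set x | f x <> g x].
  move=> mf mg; rewrite (_ : [set _ | _] = (f \- g)%R @^-1` (~` [set 0%R])).
    have mfg : measurable_fun setT (f \- g)%R by exact: measurable_funB.
    rewrite -[X in measurable X]setTI; apply: mfg => //.
    by apply: measurableC; exact: measurable_set1.
  apply/seteqP; split => x /=; apply: contra_not.
    by move/eqP; rewrite subr_eq0 => /eqP.
  by move=> ->; rewrite subrr.
pose A := [set z : Rn R n * Rn R n | v z.1 <> v z.2].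
have mA : measurable A by apply: mneq; exact: measurableT_comp.
have /eqP PA0 : (m \x m) A == 0 by apply/eqP/negligibleP.
have mphi := measurable_fun_xsection m mA.
have phi0 : ae_eq m setT (m \o xsection A) (cst 0).
  apply/(ae_eq_integral_abs m measurableT mphi).
  by rewrite -[RHS]PA0; apply: eq_integral => x _; rewrite gee0_abs.
(* A base point with null section is found because the space is not null; in the null case any
   constant works. *)
have [mT0|mT] := eqVneq (m setT) 0.
  exists 0%R; apply/eqP; rewrite eq_le measure_ge0 andbT -mT0.
  by apply: le_measure; rewrite ?inE//; apply: mneq.
have [x mx] : exists x, m (xsection A x) = 0.
  apply: contrapT => /forallNP nx; move/negP: mT; apply; apply/eqP.
  apply/negligibleP => //; apply: negligibleS phi0 => x _ /=.
  by move=> phix0; apply: (nx x); exact: phix0 Logic.I.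
exists (v x); rewrite -mx; congr (m _); apply/seteqP; split => y /=.
- by move=> vyx; apply/mem_set => /esym.
- by move/set_mem => /= vxy vyx; apply: vxy.
Qed.

End constancy.

(** * A bounded, injective, 1-Lipschitz change of values *)

Section bounded_reparametrization.
Context {R : realType}.

(** Boundedness provides the oscillation bound 2, the Lipschitz constant 1 keeps difference
    quotients from growing, and injectivity allows constancy to be pulled back. *)
Definition squash (t : R) : R := t / (1 + `|t|).

Let den_gt0 (t : R) : 0 < 1 + `|t|.
Proof. by rewrite ltr_pwDl. Qed.

Lemma squash_inj : injective squash.
Proof.
move=> a b /eqP; rewrite /squash eqr_div ?(gt_eqF (den_gt0 _))// => /eqP ab.
have a0 := normr_ge0 a; have b0 := normr_ge0 b.
have : a + a * `|b| = b + b * `|a|.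
  by rewrite -[X in X + _ = _]mulr1 -[X in _ = X + _]mulr1 -!mulrDr.
have [] := leP 0 a; have [] := leP 0 b => b_s a_s.
- by rewrite (ger0_norm b_s) (ger0_norm a_s); lra.
- by rewrite (ltr0_norm b_s) (ger0_norm a_s); nra.
- by rewrite (ger0_norm b_s) (ltr0_norm a_s); nra.
- by rewrite (ltr0_norm b_s) (ltr0_norm a_s); lra.
Qed.

Lemma norm_squash_le1 a : `|squash a| <= 1.
Proof.
rewrite normrM normfV (gtr0_norm (den_gt0 a)) ler_pdivrMr// mul1r.
by rewrite lerDr.
Qed.

Lemma squash_osc a b : `|squash a - squash b| <= 2.
Proof.
apply: le_trans (ler_normB _ _) _.
by have := norm_squash_le1 a; have := norm_squash_le1 b; lra.
Qed.

Lemma squash_lipschitz a b : `|squash a - squash b| <= `|a - b|.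
Proof.
have a0 := normr_ge0 a; have b0 := normr_ge0 b.
wlog ab : a b a0 b0 / b <= a.
  move=> W; have [ba|/ltW ab] := leP b a; first exact: W.
  by rewrite distrC [leRHS]distrC; exact: W.
have mono : squash b <= squash a.
  rewrite /squash ler_pdivrMr// mulrAC ler_pdivlMr//.
  have [a_s|a_s] := leP 0 a; have [b_s|b_s] := leP 0 b;
    rewrite ?(ger0_norm a_s) ?(ltr0_norm a_s) ?(ger0_norm b_s) ?(ltr0_norm b_s); nra.
rewrite !ger0_norm ?subr_ge0//.
have den : squash a - squash b =
    (a - b + (a * `|b| - b * `|a|)) / ((1 + `|a|) * (1 + `|b|)).
  by rewrite /squash; field; rewrite !gt_eqF.
(* The cross term in the numerator vanishes when the signs agree; otherwise it is [-2ab], at most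
   [(a - b)^2 = (a - b)(|a| + |b|)]. *)
rewrite den ler_pdivrMr ?mulr_gt0//.
have ab0 : 0 <= a - b by rewrite subr_ge0.
have := mulr_ge0 ab0 (mulr_ge0 a0 b0); have := mulr_ge0 ab0 (addr_ge0 a0 b0).
have := sqr_ge0 a; have := sqr_ge0 b.
have [a_s|a_s] := leP 0 a; have [b_s|b_s] := leP 0 b;
    rewrite ?(ger0_norm a_s) ?(ltr0_norm a_s) ?(ger0_norm b_s) ?(ltr0_norm b_s); nra.
Qed.

Lemma measurable_squash : measurable_fun setT squash.
Proof.
rewrite (_ : squash = fun t => t * (1 + `|t|) `^ (-1)); last first.
  by apply/funext => t; rewrite powR_inv1// ltW.
apply: measurable_funM => //; apply: (measurableT_comp (@measurable_powR R _)).
exact: measurable_funD.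
Qed.

End bounded_reparametrization.

(** * Comparison of level sets after modification on a null set *)

Section level_sets.
Local Open Scope ereal_scope.
Context {R : realType} {n : nat}.
Let m := borel_lebesgue R n.

Lemma diff_quotient_le (p : R) (u v : Rn R n -> R) z :
  (`|v z.1 - v z.2| <= `|u z.1 - u z.2|)%R ->
  (`|diff_quotient p v z| <= `|diff_quotient p u z|)%R.
Proof.
move=> vu; rewrite !norm_diff_quotient ler_wpM2r//.
by rewrite invr_ge0 powR_ge0.
Qed.

(** Outside the null set [W] of pairs with a coordinate in [Z], the level set for [v] is contained
    in that for [u]. [lebesgue2] is the outer measure of the product, hence monotone and subadditive
    on arbitrary sets. *)
Lemma product_level_le (p : R) (u v : Rn R n -> R) (Z : set (Rn R n)) (l : R) :
  measurable_fun setT v -> measurable Z -> m Z = 0 ->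
  (forall x y, ~ Z x -> ~ Z y -> (`|v x - v y| <= `|u x - u y|)%R) ->
  (m \x m) [set z | (l <= `|diff_quotient p v z|)%R] <=
  lebesgue2 R n [set z | (l <= `|diff_quotient p u z|)%R].
Proof.
move=> mv mZ Z0 vu; pose W := (Z `*` setT) `|` (setT `*` Z).
have mW : measurable W by apply: measurableU; exact: measurableX.
have W0 : (m \x m) W = 0.
  apply/negligibleP => //; apply: negligibleU; apply/negligibleP.
  - exact: measurableX.
  - by apply: etrans (product_measure1E m m mZ measurableT) _;
      rewrite [X in X * _]Z0 mul0e.
  - exact: measurableX.
  - by apply: etrans (product_measure1E m m measurableT mZ) _;
      rewrite [X in _ * X]Z0 mule0.
rewrite -(measurable_mu_extE (m \x m) (measurable_diff_quotient_ge p mv l)).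
pose Eu := [set z | (l <= `|diff_quotient p u z|)%R].
apply: (@le_trans _ _ (((m \x m)^*)%mu (Eu `|` W))).
  apply: le_mu_ext => z /= lz; have [Wz|Wz] := pselect (W z); first by right.
  left; apply: le_trans lz _; apply: diff_quotient_le; apply: vu => Zz.
    by apply: Wz; left.
  by apply: Wz; right.
apply: le_trans (outer_measureU2 _ _ _) _.
rewrite [X in _ + X](_ : _ = 0) ?adde0//.
by rewrite -[RHS]W0; exact: measurable_mu_extE.
Qed.

Lemma lebesgue2_level_nonincreasing (p : R) (u : Rn R n -> R) (x y : R) :
  (x <= y)%R ->
  lebesgue2 R n [set z | (y <= `|diff_quotient p u z|)%R] <=
  lebesgue2 R n [set z | (x <= `|diff_quotient p u z|)%R].
Proof. by move=> xy; apply: le_mu_ext => z /=; exact: le_trans. Qed.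

End level_sets.

(** * Reduction to a bounded Borel function and transfer of constancy back to [u] *)

Theorem theorem1 (R : realType) (N : nat) (p q : R) (u : Rn R N -> R)
    (N_ge1 : (1 <= N)%N) (p_ge1 : 1 <= p) (q_ge1 : 1 <= q)
    (u_measurable : measurable_fun [set: lebesgue_type R N] u)
    (u_lorentz :
      (lorentz_norm (lebesgue2 R N) p q (diff_quotient p u) < +oo)%E) :
  exists c : R, {ae lebesgue R N, forall x, u x = c}.
Proof.
have p_gt0 : 0 < p by exact: lt_le_trans p_ge1.
have q_gt0 : 0 < q by exact: lt_le_trans q_ge1.
have [w [Z [mw mZ Z0 wu]]] := measurable_fun_caratheodory_ae u_measurable.
pose v := squash \o w.
have mv : measurable_fun setT v by apply: measurableT_comp => //; exact: measurable_squash.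
have v_osc x y : `|v x - v y| <= 2 by exact: squash_osc.
pose M (l : R) := lebesgue2 R N [set z | (l <= `|diff_quotient p u z|)%R].
have M0 l : (0 <= M l)%E by exact: mu_ext_ge0.
have vM l : ((borel_lebesgue R N \x borel_lebesgue R N)
    [set z | (l <= `|diff_quotient p v z|)%R] <= M l)%E.
  rewrite /M; apply: (@product_level_le _ _ p u v Z l mv mZ Z0) => x y Zx Zy.
  by rewrite -(wu x Zx) -(wu y Zy); exact: squash_lipschitz.
(* Finiteness passes from the norm to the integral since the exponent [q^-1] is nonzero and the
   factor [p] is positive. *)
have Moo : (\int[lebesgue_measure]_(l in `]0%R, +oo[)
    ((l `^ q)%:E * M l `^ (q / p) * (l^-1)%:E) < +oo)%E.
  have q_neq0 : q^-1 != 0 by rewrite invr_eq0 gt_eqF.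
  have pI := lty_poweRy q_neq0 u_lorentz.
  rewrite ltey; apply/eqP => Ioo; move: pI.
  by rewrite [X in (_ * X)%E]Ioo gt0_muley ?lte_fin// ltxx.
have v_neg : (borel_lebesgue R N \x borel_lebesgue R N)%E.-negligible
    [set z | v z.1 <> v z.2].
  apply: (negligible_osc (p := p) mv) => s r s0 r0.
  apply: shell_integral_eq0 => // L L0 a.
  have [Mfin Msmall] := lorentz_level_vanish p_ge1 q_ge1 L0 M0
    (@lebesgue2_level_nonincreasing _ _ p u) Moo.
  have aM j : (a j <= ((L * 2 ^+ j) `^ p)%:E * M (L * 2 ^+ j)%R)%E.
    by rewrite lee_wpmul2l ?lee_fin ?powR_ge0.
  split => [j|e e0].
    by apply: le_lt_trans (aM j) _; rewrite lte_mul_pinfty ?lee_fin ?powR_ge0.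
  have [J Jsmall] := Msmall e e0.
  by exists J => j Jj; exact: le_trans (aM j) (Jsmall j Jj).
have [c vc] := ae_constant_of_negligible mv v_neg.
(* If [v] takes the value [c] at [x], injectivity of [squash] makes [w x] the constant. If it never
   does, the right-hand set is the whole space and 0 will do. *)
have [c' c'E] : exists c' : R, [set x | w x <> c'] `<=` [set x | v x <> c].
  have [[x vx]|nx] := pselect (exists x, v x = c).
    by exists (w x) => y /= wy vy; apply: wy; apply: squash_inj; rewrite -vx in vy.
  by exists 0 => y _ /= vy; apply: nx; exists y.
have mvc : measurable [set x | v x <> c].
  rewrite (_ : [set _ | _] = v @^-1` (~` [set c]))//.
  rewrite -[X in measurable X]setTI; apply: mv => //.
  by apply: measurableC; exact: measurable_set1.
exists c', (Z `|` [set x | v x <> c]); split.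
- apply: caratheodory_measurable_mu_ext; exact: measurableU.
- apply: etrans (measurable_mu_extE (borel_lebesgue R N) (measurableU _ _ mZ mvc)) _.
  apply/negligibleP; first exact: measurableU.
  by apply: negligibleU; apply/negligibleP.
- move=> x /= uc; have [Zx|Zx] := pselect (Z x); [by left|right].
  by apply: c'E => /= wc; apply: uc; rewrite -(wu x Zx).
Qed.
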